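(* Let $R$ be a ring and $I$ a radical ideal of $R$. Then the following statements hold. (1) If the additive group of $R$ is torsion-free, then $\omega_{R[X]}(I[X])=\omega_R(I)$. (2) If $R$ is a Noetherian ring and the additive group of $R$ is torsion-free, then $\omega_{R[[X]]}(I[[X]])=\omega_R(I)$.
   Context: All rings are commutative with identity $1\neq 0$. An ideal $I$ is radical if $I=\sqrt{I}$. For an ideal $I$ of $R$, $I[X]$ (resp. $I[[X]]$) denotes the ideal of $R[X]$ (resp. $R[[X]]$) consisting of the polynomials (resp. formal power series) all of whose coefficients lie in $I$. For a positive integer $n$, a proper ideal $I$ of a ring $R$ is an $n$-absorbing ideal of $R$ if whenever $x_1\cdots x_{n+1}\in I$ for $x_1,\ldots,x_{n+1}\in R$, then there are $n$ of the $x_i$'s whose product is in $I$. For a proper ideal $I$ of $R$, $\omega_R(I)=\min\{n\geq 1 : I \text{ is an } n\text{-absorbing ideal of } R\}$, with $\omega_R(I)=\infty$ if $I$ is not $n$-absorbing for any positive integer $n$; moreover $\omega_R(R)=0$. *)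

(* Defs.v *)
From HB Require Import structures.
From mathcomp Require Import all_boot all_order all_algebra.
From mathcomp Require Import boolp classical_sets constructive_ereal.

Set Implicit Arguments.
Unset Strict Implicit.
Unset Printing Implicit Defensive.
Import GRing.Theory.
Local Open Scope classical_set_scope.
Local Open Scope ring_scope.

Definition torsion_free (V : zmodType) : Prop :=
  forall (n : nat) (x : V), (0 < n)%N -> x *+ n = 0 -> x = 0.

(* [idealr] of ring_quotient only covers proper ideals given by a boolean
   predicate, whereas the unit ideal is allowed here. *)
Definition is_ideal (R : comNzRingType) (I : set R) : Prop :=
  [/\ I 0, forall x y, I x -> I y -> I (x + y) & forall a x, I x -> I (a * x)].

Definition radical (R : comNzRingType) (I : set R) : set R :=
  [set x | exists2 n : nat, (0 < n)%N & I (x ^+ n)].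

Definition radical_ideal (R : comNzRingType) (I : set R) : Prop :=
  is_ideal I /\ I = radical I.

Definition ideal_span (R : comNzRingType) (s : seq R) : set R :=
  [set x | exists c : 'I_(size s) -> R, x = \sum_(i < size s) c i * s`_i].

Definition noetherian (R : comNzRingType) : Prop :=
  forall J : set R, is_ideal J -> exists s : seq R, J = ideal_span s.

(* A choice of [n] of the [n.+1] factors is the omission of one index [j]. *)
Definition absorbing (R : comNzRingType) (n : nat) (I : set R) : Prop :=
  [/\ (0 < n)%N, is_ideal I, I <> setT &
      forall x : 'I_n.+1 -> R,
        I (\prod_i x i) -> exists j, I (\prod_(i | i != j) x i)].

Definition omega (R : comNzRingType) (I : set R) : \bar nat :=
  if pselect (I = setT) then (0%N)%:E%E
  else if pselect (exists n, `[< absorbing n I >]) is left exI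
       then (ex_minn exI)%:E%E
       else +oo%E.

Record fps (R : comNzRingType) := Fps { fps_coef : nat -> R }.

Section FormalPowerSeries.
Variable R : comNzRingType.
Implicit Types f g h : fps R.

HB.instance Definition _ := [isNew for @fps_coef R].
HB.instance Definition _ := [Choice of fps R by <:].

Definition fps_zero : fps R := Fps (fun=> 0).
Definition fps_opp f : fps R := Fps (fun n => - fps_coef f n).
Definition fps_add f g : fps R := Fps (fun n => fps_coef f n + fps_coef g n).
Definition fps_one : fps R := Fps (fun n => (n == 0)%N%:R).
Definition fps_mul f g : fps R :=
  Fps (fun n => \sum_(i < n.+1) fps_coef f i * fps_coef g (n - i)).

Lemma fpsP f g : (forall n, fps_coef f n = fps_coef g n) -> f = g.
Proof. by move=> fg; apply: val_inj; apply: funext. Qed.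

Lemma fps_addA : associative fps_add.
Proof. by move=> f g h; apply: fpsP => n /=; rewrite addrA. Qed.
Lemma fps_addC : commutative fps_add.
Proof. by move=> f g; apply: fpsP => n /=; rewrite addrC. Qed.
Lemma fps_add0 : left_id fps_zero fps_add.
Proof. by move=> f; apply: fpsP => n /=; rewrite add0r. Qed.
Lemma fps_addN : left_inverse fps_zero fps_opp fps_add.
Proof. by move=> f; apply: fpsP => n /=; rewrite addNr. Qed.

HB.instance Definition _ :=
  GRing.isZmodule.Build (fps R) fps_addA fps_addC fps_add0 fps_addN.

Let trunc n f : {poly R} := \poly_(i < n.+1) fps_coef f i.

Let coef_trunc n f m : (m <= n)%N -> (trunc n f)`_m = fps_coef f m.
Proof. by move=> mn; rewrite coef_poly ltnS mn. Qed.

Let coef_truncM n f g m : (m <= n)%N ->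
  fps_coef (fps_mul f g) m = (trunc n f * trunc n g)`_m.
Proof.
move=> mn; rewrite coefM; apply: eq_bigr => i _ /=.
have im : (i <= m)%N by rewrite -ltnS.
by rewrite !coef_trunc // (leq_trans _ mn) // leq_subr.
Qed.

Lemma fps_mulC : commutative fps_mul.
Proof.
move=> f g; apply: fpsP => n.
by rewrite (coef_truncM f g (leqnn n)) mulrC -coef_truncM.
Qed.

Lemma fps_mulA : associative fps_mul.
Proof.
move=> f g h; apply: fpsP => n.
transitivity (trunc n f * (trunc n g * trunc n h))`_n.
  rewrite coefM; apply: eq_bigr => i _.
  have le_in : (i <= n)%N by rewrite -ltnS.
  by rewrite coef_trunc // -coef_truncM // leq_subr.
rewrite mulrA coefM; apply: eq_bigr => i _.
have le_in : (i <= n)%N by rewrite -ltnS.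
by rewrite -coef_truncM // coef_trunc // leq_subr.
Qed.

Lemma fps_mul1 : left_id fps_one fps_mul.
Proof.
move=> f; apply: fpsP => n /=.
rewrite big_ord_recl /= mul1r subn0 big1 ?addr0 // => i _.
by rewrite mul0r.
Qed.

Lemma fps_mulDl : left_distributive fps_mul +%R.
Proof.
move=> f g h; apply: fpsP => n /=.
by rewrite -big_split; apply: eq_bigr => i _; rewrite /= mulrDl.
Qed.

Lemma fps_one_neq0 : fps_one != 0.
Proof.
apply/eqP => /(congr1 (fun f => fps_coef f 0)) /= /eqP.
by rewrite (negPf (oner_neq0 R)).
Qed.

HB.instance Definition _ := GRing.Zmodule_isComNzRing.Build (fps R)
  fps_mulA fps_mulC fps_mul1 fps_mulDl fps_one_neq0.

End FormalPowerSeries.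

Definition poly_ideal (R : comNzRingType) (I : set R) : set {poly R} :=
  [set p | forall i : nat, I p`_i].

Definition fps_ideal (R : comNzRingType) (I : set R) : set (fps R) :=
  [set f | forall i : nat, I (fps_coef f i)].

(* Main.v *)
(** An [n]-absorbing radical ideal [I] has at most [n] minimal primes.  If a
    product of [n.+1] power series lies in [I[[X]]] but no subproduct of [n]
    of them does, then omitting the [j]-th factor yields a minimal prime [Q j]
    of [I] such that the [j]-th factor is the only one in [(Q j)[[X]]].  These
    [n.+1] primes are pairwise incomparable, which prevents [I] from being
    [n]-absorbing.  The converse direction and the polynomial case follow by
    contraction along [R -> R[X] -> R[[X]]]. *)
Require Import Defs.
From HB Require Import structures.
From mathcomp Require Import all_boot all_order all_algebra.
From mathcomp Require Import boolp classical_sets constructive_ereal.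
From mathcomp Require Import ring.

Set Implicit Arguments.
Unset Strict Implicit.
Unset Printing Implicit Defensive.
Import GRing.Theory.
Local Open Scope classical_set_scope.
Local Open Scope ring_scope.

(** * Ideals, primes and minimal primes *)

Lemma ideal_sum (R : comNzRingType) (I : set R) (T : finType) (P : pred T)
    (x : T -> R) :
  is_ideal I -> (forall i, P i -> I (x i)) -> I (\sum_(i | P i) x i).
Proof. by move=> [I0 ID _] Ix; apply: big_ind. Qed.

(** Shaped for use after [bigD1], which puts the isolated term [y] first. *)
Lemma ideal_addr (R : comNzRingType) (I : set R) (x y : R) :
  is_ideal I -> I x -> I (y + x) -> I y.
Proof.
move=> [_ ID IM] Ix Iyx; rewrite -(addrK x y) -mulN1r.
by apply: ID => //; apply: IM.
Qed.

Lemma radical_ideal_exp (R : comNzRingType) (I : set R) (x : R) n :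
  radical_ideal I -> I (x ^+ n.+1) -> I x.
Proof. by move=> [_ eqI] Ixn; rewrite eqI; exists n.+1. Qed.

Definition prime_ideal (R : comNzRingType) (Q : set R) : Prop :=
  [/\ is_ideal Q, ~ Q 1 & forall x y, Q (x * y) -> Q x \/ Q y].

(** The complement of [Q] contains [1] and is closed under products. *)
Lemma prime_ideal_prod (R : comNzRingType) (Q : set R) (T : finType)
    (P : pred T) (x : T -> R) :
  prime_ideal Q -> Q (\prod_(i | P i) x i) -> exists2 i, P i & Q (x i).
Proof.
move=> [_ Q1 QM] Qx; apply: contrapT => noti; move: Qx.
apply: (big_ind (fun y => ~ Q y)) => // [y z Qy Qz /QM[]//|i Pi Qi].
by apply: noti; exists i.
Qed.

(* For radical [I] these are the minimal primes of [I]: the last clause says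
   that [I] becomes [Q] after localization at [Q]. *)
Definition minimal_prime (R : comNzRingType) (I Q : set R) : Prop :=
  [/\ prime_ideal Q, I `<=` Q
    & forall x, Q x -> exists2 s, ~ Q s & I (s * x)].

(* The complement of [Q] is a maximal multiplicative set [S] such that
   [s * x] avoids [I] for all [s] in [S]; maximality forces [1] and [x]
   to be in [S]. *)
Lemma exists_minimal_prime (R : comNzRingType) (I : set R) (x : R) :
  radical_ideal I -> ~ I x -> exists2 Q, minimal_prime I Q & ~ Q x.
Proof.
move=> radI notIx; have [[I0 ID IM] _] := radI.
pose mulset (S : set R) := (forall a b, S a -> S b -> S (a * b)) /\
  forall s, S s -> ~ I (s * x).
have [F Fmul totF|S [[SM SI] maxS]] := @Zorn_bigcup R mulset.
  split=> [a b [A FA Aa] [B FB Bb]|s [A FA As]]; last exact: (Fmul A FA).2.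
  have [AB|BA] := totF A B FA FB.
    by exists B => //; apply: (Fmul B FB).1 => //; apply: AB.
  by exists A => //; apply: (Fmul A FA).1 => //; apply: BA.
(* The empty set satisfies [mulset], so [1] is allowed separately until [S 1] is known. Without such
   an [s], adjoining the powers of [z] to [S] would contradict maximality. *)
have outS z : ~ S z -> exists2 s, S s \/ s = 1 & I (s * z * x).
  move=> notSz; apply: contrapT => noS.
  pose T : set R := [set w | exists s m, (S s \/ s = 1) /\ w = s * z ^+ m].
  apply: (maxS T); first split.
  - by move=> s Ss; exists s, 0; split; [left|rewrite expr0 mulr1].
  - by move=> /(_ z); apply: contra_not notSz; apply; exists 1, 1;
      split; [right|rewrite expr1 mul1r].
  split=> [_ _ [s [m [Ss ->]]] [t [k [St ->]]]|_ [s [m [Ss ->]]] Isx].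
    exists (s * t), (m + k)%N; split; last by rewrite exprD mulrACA.
    case: Ss St => [Ss|->] [St|->]; rewrite ?mulr1 ?mul1r; by [left; auto|right].
  (* The power [m.+1] of [s * z * x] is a multiple of [s * z ^+ m * x], and the exponent is positive
     even for [m = 0]. *)
  apply: noS; exists s => //; apply: (@radical_ideal_exp _ _ _ m radI).
  have -> : (s * z * x) ^+ m.+1 = s ^+ m * z * x ^+ m * (s * z ^+ m * x).
    by rewrite !exprMn !exprS; ring.
  exact: IM.
have S1 : S 1.
  apply: contrapT => /outS[s [Ss|->]]; rewrite mulr1; first exact: SI.
  by rewrite mul1r.
have {}outS z : ~ S z -> exists2 s, S s & I (s * z * x).
  by move=> /outS[s [Ss|->] Iszx]; [exists s|exists 1].
have Sx : S x.
  apply: contrapT => /outS[s Ss Isxx]; apply: (SI s Ss).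
  apply: (@radical_ideal_exp _ _ _ 1 radI).
  have -> : (s * x) ^+ 2 = s * (s * x * x) by ring.
  exact: IM.
(* Since [x] is in [S], it is absorbed into the multiplier. Together with [notSI], this describes
   the complement of [S] as the elements that some [s] in [S] sends into [I]. *)
have {}outS z : ~ S z -> exists2 s, S s & I (s * z).
  move=> /outS[s Ss Iszx]; exists (s * x); first exact: SM.
  by rewrite mulrAC.
have notSI z s : S s -> I (s * z) -> ~ S z.
  move=> Ss Isz Sz; apply: (SI (s * z)); first exact: SM.
  by rewrite mulrC; apply: IM.
exists (~` S); last by move/(_ Sx).
split=> [|z Iz Sz|z /outS[s Ss Isz]]; first split=> [|/(_ S1)//|a b notSab].
- split=> [|a b /outS[s Ss Isa] /outS[t St Itb]|a b /outS[s Ss Isb]].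
  + by apply: (notSI _ _ S1); rewrite mulr0.
  + apply: (notSI _ (s * t)); first exact: SM.
    rewrite mulrDr; apply: ID; last by rewrite -mulrA; apply: IM.
    by rewrite [s * t]mulrC -mulrA; apply: IM.
  + by apply: (notSI _ s) => //; rewrite mulrCA; apply: IM.
- by apply: contrapT => /not_orP[/contrapT Sa /contrapT Sb]; apply/notSab/SM.
- by apply: (SI z Sz); rewrite mulrC; apply: IM.
- by exists s => //; move/(_ Ss).
Qed.

(* With [s i] in every [Q j] but [Q i], the sum [z i] of the other [s j] lies
   in [Q i] only, and some [t] outside all the [Q j] sends [\prod_i z i] into
   [I]: the factors [t * z i] contradict the absorbing property. *)
Lemma absorbing_minimal_primes (R : comNzRingType) (I : set R) n
    (Q : 'I_n.+1 -> set R) :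
  absorbing n I -> (forall i, minimal_prime I (Q i)) ->
  (forall i j, i != j -> exists2 x, Q j x & ~ Q i x) -> False.
Proof.
move=> [_ [I0 ID IM] _ absI] minQ sepQ.
have primeQ i : prime_ideal (Q i) by case: (minQ i).
have idealQ i : is_ideal (Q i) by case: (primeQ i).
have QM i a x : Q i x -> Q i (a * x) by case: (idealQ i) => _ _; apply.
have /choice[s sP] : forall i, exists x, ~ Q i x /\
    forall j, i != j -> Q j x.
  move=> i.
  have /choice[e eP] : forall j, exists x, i != j -> Q j x /\ ~ Q i x.
    (* The value [0] at [j = i] is a placeholder: the product below omits that index. *)
    move=> j; have [->|/(sepQ i j)[x Qx nQx]] := eqVneq i j; first by exists 0.
    by exists x.
  exists (\prod_(j | i != j) e j); split=> [|j ij].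
    by move=> /(prime_ideal_prod (primeQ i))[j /eP[]].
  by rewrite (bigD1 j) //= mulrC; apply: QM; case: (eP j ij).
pose z i := \sum_(j | j != i) s j.
have Qz i : Q i (z i) by apply: ideal_sum => // j ji; apply: (sP j).2.
have nQz i j : i != j -> ~ Q j (z i).
  move=> ij; rewrite /z (bigD1 j) 1?eq_sym //= => Qzi.
  apply: (sP j).1; apply: (@ideal_addr _ _ _ _ (idealQ j) _ Qzi).
  by apply: ideal_sum => // k /andP[_ kj]; apply: (sP k).2.
have /choice[u uP] : forall i, exists u, ~ Q i u /\ I (u * z i).
  by move=> i; case: (minQ i) => _ _ /(_ _ (Qz i))[u]; exists u.
(* Each term sends [\prod_i z i] into [I] through its factor [u i], while modulo [Q j] only the
   [j]-th term survives. *)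
pose t := \sum_i s i * u i.
have nQt j : ~ Q j t.
  rewrite /t (bigD1 j) //= => Qt.
  have [_ _ /(_ (s j) (u j))[|/(sP j).1//|/(uP j).1//]] := primeQ j.
  apply: (@ideal_addr _ _ _ _ (idealQ j) _ Qt); apply: ideal_sum => // k kj.
  by rewrite mulrC; apply/QM/(sP k).2.
have [|j] := absI (fun i => t * z i).
  rewrite big_split /= big_ord_recl -mulrA mulrCA; apply: (IM).
  rewrite mulr_suml; apply: ideal_sum => // k _.
  rewrite (bigD1 k) //=; set p := \prod_(i | _) _.
  have -> : s k * u k * (z k * p) = s k * p * (u k * z k) by ring.
  exact/IM/(uP k).2.
have [_ IQ _] := minQ j.
move=> /IQ/(prime_ideal_prod (primeQ j))[i ij].
by have [_ _ QMj] := primeQ j => /QMj[]; [apply: nQt|apply: nQz].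
Qed.

(** * Extension of ideals to power series *)

Lemma fps_ideal_is_ideal (R : comNzRingType) (I : set R) :
  is_ideal I -> is_ideal (fps_ideal I).
Proof.
move=> idI; have [I0 ID IM] := idI.
split=> [i //|f g If Ig i|f g Ig i]; first exact: ID.
by apply: ideal_sum => // k _; apply: IM.
Qed.

(** If the first coefficients of [f] and [g] outside [Q] have indices [m] and [l], then modulo [Q]
    the coefficient of [f * g] at [m + l] is the product of these two. *)
Lemma fps_ideal_prime (R : comNzRingType) (Q : set R) :
  prime_ideal Q -> prime_ideal (fps_ideal Q).
Proof.
move=> [idQ Q1 QM]; have [_ _ QMl] := idQ.
split; [exact: fps_ideal_is_ideal|by move=> /(_ 0)|move=> f g Qfg].
have least (h : fps R) : ~ fps_ideal Q h ->
    exists2 m, ~ Q (fps_coef h m) & forall k, (k < m)%N -> Q (fps_coef h k).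
  move=> /existsNP[i nQi].
  have exi : exists i, ~~ `[< Q (fps_coef h i) >] by exists i; apply/asboolPn.
  case: (ex_minnP exi) => m /asboolPn nQm minm; exists m => // k km.
  by apply: contrapT => /asboolPn/minm; rewrite leqNgt km.
apply: contrapT => /not_orP[/least[m nQf Qf] /least[l nQg Qg]].
have ml : (m < (m + l).+1)%N by rewrite ltnS leq_addr.
have /= := Qfg (m + l)%N; rewrite (bigD1 (Ordinal ml)) //= addKn => Qml.
have [|//|//] := QM (fps_coef f m) (fps_coef g l).
apply: (@ideal_addr _ _ _ _ idQ _ Qml); apply: ideal_sum => // -[k kml] /=.
rewrite -val_eqE /= neq_ltn => /orP[/Qf|mk]; first by rewrite mulrC; apply: QMl.
by apply/QMl/Qg; rewrite ltn_subLR ?ltn_add2r.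
Qed.

Lemma fps_ideal_setT (R : comNzRingType) (I : set R) :
  fps_ideal I = setT -> I = setT.
Proof.
move=> IT; apply/seteqP; split=> // x _.
have : fps_ideal I (Fps (fun=> x)) by rewrite IT.
by move/(_ 0).
Qed.

Lemma poly_ideal_setT (R : comNzRingType) (I : set R) :
  poly_ideal I = setT -> I = setT.
Proof.
move=> IT; apply/seteqP; split=> // x _.
have : poly_ideal I x%:P by rewrite IT.
by move/(_ 0); rewrite coefC.
Qed.

Lemma absorbing_fps_ideal (R : comNzRingType) (I : set R) n :
  radical_ideal I -> absorbing n I -> absorbing n (fps_ideal I).
Proof.
move=> radI absI; have [n0 idI IT _] := absI.
split=> // [||f If]; [exact: fps_ideal_is_ideal|by move/fps_ideal_setT|].
apply: contrapT => /forallNP nIf.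
have /choice[Q QP] : forall j, exists Q, minimal_prime I Q /\
    ~ fps_ideal Q (\prod_(i | i != j) f i).
  (* Some coefficient of the [j]-th subproduct is outside [I]; [Q j] is chosen to avoid it. *)
  move=> j; have /existsNP[k] := nIf j.
  by move=> /(exists_minimal_prime radI)[Q minQ Qk]; exists Q; split=> // /(_ k).
have minQ j : minimal_prime I (Q j) := (QP j).1.
have primeQX j : prime_ideal (fps_ideal (Q j)).
  by apply: fps_ideal_prime; case: (minQ j).
have nQf i j : i != j -> ~ fps_ideal (Q j) (f i).
  move=> ij Qfi; apply: (QP j).2; rewrite (bigD1 i) //= mulrC.
  by have [[_ _ QM] _ _] := primeQX j; apply: QM.
have Qf j : fps_ideal (Q j) (f j).
  have [_ IQ _] := minQ j.
  have /(prime_ideal_prod (primeQX j))[i _] :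
    fps_ideal (Q j) (\prod_i f i) by move=> k; apply/IQ/If.
  by have [->//|/nQf] := eqVneq i j.
apply: (absorbing_minimal_primes absI minQ) => i j ij.
(* The separating element is a coefficient of [f j]: all of them lie in [Q j], but not all in
   [Q i]. *)
have /nQf/existsNP[k nQk] : j != i by rewrite eq_sym.
by exists (fps_coef (f j) k) => //; apply: Qf.
Qed.

(** * Contraction of ideals and comparison of [omega] *)

(** The index omitted for the images under [phi] also serves for the original factors, and
    [phi 1 = 1] keeps the preimage proper. *)
Lemma absorbing_preimage (A B : comNzRingType) (phi : {rmorphism A -> B})
    (J : set B) n :
  absorbing n J -> absorbing n (phi @^-1` J).
Proof.
move=> [n0 [J0 JD JM] JT absJ]; split=> //.
- split=> [|x y Jx Jy|a x Jx]; rewrite /preimage /=.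
  + by rewrite rmorph0.
  + by rewrite rmorphD; apply: JD.
  + by rewrite rmorphM; apply: JM.
- move=> phiJT; apply: JT; apply/seteqP; split=> // y _.
  have : (phi @^-1` J) 1 by rewrite phiJT.
  by rewrite /preimage /= rmorph1 => J1; rewrite -[y]mulr1; apply: JM.
- move=> x; rewrite /preimage /= rmorph_prod => /absJ[j Jj].
  by exists j; rewrite rmorph_prod.
Qed.

Section FpsOfPoly.
Variable R : comNzRingType.

Definition fps_of_poly (p : {poly R}) : fps R := Fps (nth 0 p).

Lemma fps_of_poly_zmod_morphism : zmod_morphism fps_of_poly.
Proof. by move=> p q; apply: fpsP => i /=; rewrite coefB. Qed.

Lemma fps_of_poly_monoid_morphism : monoid_morphism fps_of_poly.
Proof.
by split=> [|p q]; apply: fpsP => i /=; [rewrite coef1|rewrite coefM].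
Qed.

HB.instance Definition _ :=
  GRing.isZmodMorphism.Build {poly R} (fps R) fps_of_poly
    fps_of_poly_zmod_morphism.
HB.instance Definition _ :=
  GRing.isMonoidMorphism.Build {poly R} (fps R) fps_of_poly
    fps_of_poly_monoid_morphism.

End FpsOfPoly.

Lemma preimage_polyC (R : comNzRingType) (I : set R) :
  I 0 -> polyC @^-1` poly_ideal I = I.
Proof.
move=> I0; apply/seteqP; split=> x; first by move/(_ 0); rewrite coefC.
by move=> Ix i; rewrite coefC; case: ifP.
Qed.

(** The unit ideal is compared separately because it is never absorbing and has the special value
    [0]. *)
Lemma eq_omega (A B : comNzRingType) (I : set A) (J : set B) :
  (I = setT <-> J = setT) -> (forall n, absorbing n I <-> absorbing n J) ->
  omega I = omega J.
Proof.
move=> eqT eqabs; rewrite /omega.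
have eqb n : `[< absorbing n I >] = `[< absorbing n J >].
  exact: asbool_equiv_eq.
case: (pselect (I = setT)) => IT; case: (pselect (J = setT)) => JT //=.
- by case: JT; apply/eqT.
- by case: IT; apply/eqT.
case: pselect => exI; case: pselect => exJ //.
- by congr (_%:E)%E; apply: eq_ex_minn.
- by case: exJ; case: exI => n In; exists n; rewrite -eqb.
- by case: exI; case: exJ => n Jn; exists n; rewrite eqb.
Qed.

Theorem corollary16 (R : comNzRingType) (I : set R) (radI : radical_ideal I) :
  (torsion_free R -> omega (poly_ideal I) = omega I) /\
  (noetherian R -> torsion_free R -> omega (fps_ideal I) = omega I).
Proof.
have [[I0 _ _] _] := radI.
have absX n : absorbing n (fps_ideal I) -> absorbing n (poly_ideal I).
  (* The preimage of [fps_ideal I] is [poly_ideal I] by conversion. *)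
  by move=> /(absorbing_preimage (@fps_of_poly R)).
have absC n : absorbing n (poly_ideal I) -> absorbing n I.
  by move=> /(absorbing_preimage polyC); rewrite preimage_polyC.
have absXX n : absorbing n I -> absorbing n (fps_ideal I).
  exact: absorbing_fps_ideal.
(* The three implications form a cycle, so [auto] settles both equivalences; the unit ideal cases
   remain. *)
split=> *; apply: eq_omega => [|n]; split; auto.
- exact: poly_ideal_setT.
- by move=> ->; apply/seteqP.
- exact: fps_ideal_setT.
- by move=> ->; apply/seteqP.
Qed.
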